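(* Let $J:\mathbb{R}^n\to\mathbb{R}$ be of class $C^2$, and let $\mathfrak{f}_1(x)=\sin(J(x))$, $\mathfrak{f}_2(x)=\cos(J(x))$. Consider either of the two algorithms $x_{k+1}=E_{g_k}^{\sqrt h}(x_k)$ (Euler version) or $x_{k+1}=H_{g_k}^{\sqrt h}(x_k)$ (Heun version) with step size parameter $h>0$, where $g_k$ is the switched vector field built from this pair $\mathfrak{f}_1,\mathfrak{f}_2$ (see context). Then, for each of the two algorithms, the evolution of $x_k\in\mathbb{R}^n$ at step $k+4n$ is given by $$x_{k+4n}=x_k-h\,\nabla_xJ(x_k)+\mathcal{O}(h^{3/2})$$ for all $k\in\mathbb{N}_0$.
   Context: Notation: $n\ge 1$; $\mathbb{N}_0=\{0,1,2,\dots\}$; $|\cdot|$ is the Euclidean norm; $C^m$ denotes the set of $m$-times differentiable functions; $\nabla_xJ(x):=\left(\frac{\partial J}{\partial x}(x)\right)^\top\in\mathbb{R}^n$ is the gradient (column vector). Integration maps: for a vector field $g:\mathbb{R}^n\to\mathbb{R}^n$ and a step $s>0$, $$E_g^{s}(x):=x+s\,g(x),\qquad H_g^{s}(x):=x+\tfrac{s}{2}\left(g(x)+g(x+s\,g(x))\right).$$ Switched vector field: for $k\in\mathbb{N}_0$ put $l=(\lfloor k/4\rfloor \bmod n)+1$, let $e_l$ be the $l$-th unit vector of $\mathbb{R}^n$, and set $$g_k(x)=\begin{cases}\ \ \mathfrak{f}_1(x)e_l & k\bmod 4=0\\ \ \ \mathfrak{f}_2(x)e_l & k\bmod 4=1\\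 -\mathfrak{f}_1(x)e_l & k\bmod 4=2\\ -\mathfrak{f}_2(x)e_l & k\bmod 4=3.\end{cases}$$ The algorithms use the step $s=\sqrt h$. Order notation: $\mathcal{O}(h^{3/2})$ stands for an $\mathbb{R}^n$-valued remainder $r(h)$ for which there exist constants $c,\bar h>0$ with $|r(h)|\le c\,h^{3/2}$ for all $h\in(0,\bar h]$. Here $x_k\in\mathbb{R}^n$ is regarded as a given point, $x_{k+4n}$ is obtained from it by the $4n$ steps $k,\dots,k+4n-1$ of the algorithm, and the constants may depend on $k$ and $x_k$. *)

(* Defs.v *)
From mathcomp Require Import all_boot all_order all_algebra.
From mathcomp Require Import all_classical all_reals all_analysis.
Import Order.TTheory GRing.Theory Num.Theory.
Import numFieldNormedType.Exports.
Set Implicit Arguments.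
Unset Strict Implicit.
Unset Printing Implicit Defensive.
Local Open Scope ring_scope.

(* The library norm `|x| on matrices is the sup norm, hence this definition. *)
Definition enorm {R : realType} {n : nat} (x : 'cV[R]_n) : R :=
  Num.sqrt (\sum_(i < n) x i 0 ^+ 2).

(* Indexed from 0: for l < n this is the (l+1)-th unit vector of R^n. *)
Definition unit_vec (R : realType) (n l : nat) : 'cV[R]_n :=
  \col_(i < n) (i == l :> nat)%:R.

Definition gradient {R : realType} {n : nat} (J : 'cV[R]_n -> R)
    (x : 'cV[R]_n) : 'cV[R]_n :=
  \col_(i < n) 'D_(unit_vec R n i) J x.

(* Twice (Frechet) differentiable on R^n; the second derivative need not be
   continuous. The gradient represents the differential of J in coordinates. *)
Definition twice_differentiable {R : realType} {n : nat}
    (J : 'cV[R]_n -> R) : Prop :=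
  (forall x, differentiable J x) /\ (forall x, differentiable (gradient J) x).

Definition euler_map {R : realType} {n : nat} (g : 'cV[R]_n -> 'cV[R]_n)
    (s : R) (x : 'cV[R]_n) : 'cV[R]_n :=
  x + s *: g x.

Definition heun_map {R : realType} {n : nat} (g : 'cV[R]_n -> 'cV[R]_n)
    (s : R) (x : 'cV[R]_n) : 'cV[R]_n :=
  x + (s / 2) *: (g x + g (x + s *: g x)).

Definition switched_field {R : realType} {n : nat} (f1 f2 : 'cV[R]_n -> R)
    (k : nat) (x : 'cV[R]_n) : 'cV[R]_n :=
  let e := unit_vec R n ((k %/ 4) %% n) in
  match (k %% 4)%N with
  | 0%N => f1 x *: e
  | 1%N => f2 x *: e
  | 2%N => - f1 x *: e
  | _ => - f2 x *: e
  end.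

(* The point x_(k+m) reached from x_k = x by the m steps k, ..., k+m-1 of
   x_(j+1) = Phi (g j) s x_j. *)
Fixpoint iterate {R : realType} {n : nat}
    (Phi : ('cV[R]_n -> 'cV[R]_n) -> R -> 'cV[R]_n -> 'cV[R]_n)
    (g : nat -> 'cV[R]_n -> 'cV[R]_n) (s : R) (k : nat) (x : 'cV[R]_n)
    (m : nat) : 'cV[R]_n :=
  match m with
  | 0%N => x
  | m'.+1 => Phi (g (k + m')%N) s (iterate Phi g s k x m')
  end.

Definition is_O_h32 {R : realType} {n : nat} (r : R -> 'cV[R]_n) : Prop :=
  exists c hbar : R, [/\ 0 < c, 0 < hbar &
    forall h, 0 < h <= hbar -> enorm (r h) <= c * h `^ (3 / 2)].

(* Main.v *)
Require Import Defs.
From mathcomp Require Import all_boot all_order all_algebra.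
From mathcomp Require Import all_classical all_reals all_analysis.
From mathcomp Require Import ring.
Import Order.TTheory GRing.Theory Num.Theory.
Import numFieldNormedType.Exports.
Local Open Scope ring_scope.

(* With s = sqrt h, the iterates started at p satisfy
   y = p + s A + s^2 B + O(s^3), where one step along a(x) e adds a(p) e to A
   and (a'(p) A + kappa a(p) a'(p) e) e to B, with kappa = 0 for Euler and
   kappa = 1/2 for Heun. Here a = +-sin J or +-cos J, so a' is the next field
   value times J'. Over four consecutive steps along e_l the sum A closes up,
   the kappa-terms cancel, and sin^2 + cos^2 = 1 leaves -(d_l J) e_l in B. Since
   everything is 4n-periodic in the step index, a window starting at any k gives
   the same total as the window starting at 0. Only differentiability of
   the gradient is assumed, but at p it makes the gradient Lipschitz, which
   already yields a quadratic Taylor remainder at p. *)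

(** * Differentiability and a quadratic Taylor remainder at a point *)

Lemma differentiable_locally_lipschitz {R : realType}
    {V W : normedModType R} (f : V -> W) p :
  differentiable f p ->
  exists2 k, 0 < k & \forall v \near (0 : V), `|f (p + v) - f p| <= k * `|v|.
Proof.
move=> df; have [k k0 kP] := linear_lipschitz (diff_continuous df).
(* Here [k] bounds the differential, and the extra 1 absorbs the little-o term. *)
exists (k + 1); first by rewrite addr_gt0.
near=> v.
rewrite (diff_locallyxC df) addrAC [f p + _]addrC addrK mulrDl.
rewrite (le_trans (ler_normD _ _))// lerD//.
near: v; exact: littleoP.
Unshelve. all: by end_near. Qed.

Lemma differentiable_scale {R : realType} {V : normedModType R} {m : nat}
    (f : V -> R) (G : V -> 'cV[R]_m) x :
  differentiable f x -> differentiable G x ->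
  differentiable (fun y => f y *: G y) x.
Proof.
move=> df dG.
have -> : (fun y => f y *: G y) =
    \sum_(i < m) (fun y => (f y * G y i 0) *: (delta_mx i 0 : 'cV[R]_m)).
  apply/funext => y; rewrite fct_sumE {1}[G y]matrix_sum_delta scaler_sumr.
  by apply: eq_bigr => i _; rewrite big_ord1 scalerA.
apply: differentiable_sum => i; apply: differentiableZl.
apply: differentiableM => //.
apply: (@differentiable_comp _ _ _ _ G (fun M : 'cV[R]_m => M i 0)) => //.
exact: differentiable_coord.
Qed.

(** By the chain rule the gradient of [f \o J] is [f' (J y) *: gradient J y], a product of
    differentiable functions. *)
Lemma twice_differentiable_comp {R : realType} {n : nat} (J : 'cV[R]_n -> R)
    (f f' : R -> R) :
  (forall t : R, is_derive t (1 : R) f (f' t)) ->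
  (forall t, differentiable f' t) ->
  twice_differentiable J ->
  twice_differentiable (f \o J) /\
  forall p v, 'd (f \o J) p v = f' (J p) * 'd J p v.
Proof.
move=> df df' [dJ ddJ].
have dfd t : differentiable f t by apply/derivable1_diffP.
have dE p v : 'd (f \o J) p v = f' (J p) * 'd J p v.
  rewrite diff_comp//= deriv1E; last exact/derivable1_diffP.
  by rewrite derive1E derive_val mulrC.
split=> //; split=> x; first exact: differentiable_comp.
rewrite (_ : gradient _ = fun y => f' (J y) *: gradient J y).
  by apply: differentiable_scale => //; exact: differentiable_comp.
apply/funext => y; apply/matrixP => i j; rewrite !mxE.
by rewrite !deriveE ?dE//; exact: differentiable_comp.
Qed.

Lemma normr_coord_le {R : realType} {n : nat} (v : 'cV[R]_n) i :
  `|v i 0| <= `|v|.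
Proof.
rewrite [leRHS]/Num.Def.normr /= mx_normrE; apply/bigmax_geP; right.
by exists (i, 0).
Qed.

Lemma diff_gradient {R : realType} {n : nat} (J : 'cV[R]_n -> R) p v :
  differentiable J p -> 'd J p v = \sum_(i < n) v i 0 * gradient J p i 0.
Proof.
move=> dJ; rewrite {1}[v]matrix_sum_delta linear_sum; apply: eq_bigr => i _.
rewrite big_ord1 linearZ/= !mxE deriveE//; congr (_ * 'd J p _).
by apply/matrixP => k l; rewrite !mxE (ord1 l) eqxx andbT.
Qed.

(** The mean value theorem for $t \mapsto J(p + t v)$ on $[0, 1]$ turns the remainder into $\sum_i
    v_i (\partial_i J(p + t v) - \partial_i J(p))$. Only gradients at [p] and at a nearby point are
    compared, so the Lipschitz bound at [p] gives at most $k |v|^2$ for each of the $n$ terms. *)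
Lemma twice_differentiable_taylor {R : realType} {n : nat}
    (J : 'cV[R]_n -> R) p :
  twice_differentiable J ->
  exists2 c, 0 <= c & \forall v \near (0 : 'cV[R]_n),
    `|J (p + v) - J p - 'd J p v| <= c * `|v| ^+ 2.
Proof.
move=> [dJ /(_ p)/differentiable_locally_lipschitz[k k0]].
move=> /nbhs_ballP[d /= d0 kP].
exists (n%:R * k); first by rewrite mulr_ge0// ltW.
apply/nbhs_ballP; exists d => //= v; rewrite -ball_normE/= sub0r normrN => vd.
rewrite (diff_gradient J p v (dJ p)).
have dphi t : is_derive t (1 : R) (fun t => J (p + t *: v))
    (\sum_(i < n) v i 0 * gradient J (p + t *: v) i 0).
  have dl : is_diff t (cst p + *:%R^~ v) (0 + *:%R^~ v) by exact: is_diffD.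
  apply: DeriveDef.
    by apply/derivable1_diffP; apply: (differentiable_comp ex_diff).
  rewrite deriveE; last exact: (differentiable_comp ex_diff).
  rewrite (diff_comp (f := cst p + *:%R^~ v))//= diff_val.
  by rewrite add0r /= scale1r diff_gradient.
have [|t t01] :=
  MVT_segment (f := fun t => J (p + t *: v)) ler01 (fun t _ => dphi t).
  apply: continuous_subspaceT => t; apply: differentiable_continuous.
  by apply/derivable1_diffP.
rewrite scale1r scale0r addr0 subr0 mulr1 => ->; rewrite -sumrB.
apply: le_trans (ler_norm_sum _ _ _) _.
have -> : n%:R * k * `|v| ^+ 2 = \sum_(i < n) k * `|v| ^+ 2.
  by rewrite sumr_const card_ord -[RHS]mulr_natl -mulrA.
apply: ler_sum => i _; rewrite -mulrBr normrM expr2 mulrCA.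
rewrite ler_pM// ?normr_coord_le//.
have -> : gradient J (p + t *: v) i 0 - gradient J p i 0 =
   (gradient J (p + t *: v) - gradient J p) i 0 by rewrite !mxE.
rewrite (le_trans (normr_coord_le _ _))//.
have tv : `|t *: v| <= `|v|.
  move: t01; rewrite in_itv/= => /andP[t0 t1].
  by rewrite normrZ ger0_norm// ler_piMl.
apply: le_trans (kP (t *: v) _) _; last by rewrite ler_pM2l.
by rewrite -ball_normE/= sub0r normrN (le_lt_trans tv).
Qed.

(** * Remainders of order $s^m$ as $s \to 0^+$ *)

Definition rate {R : realType} {V : normedModType R} (m : nat) (u : R -> V) :=
  exists c, \forall s \near 0^'+%classic, `|u s| <= c * s ^+ m.

Section Rate.
Context {R : realType} {V : normedModType R}.
Implicit Types (u v : R -> V) (m : nat).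

Lemma rateD m u v : rate m u -> rate m v -> rate m (fun s => u s + v s).
Proof.
move=> [c cu] [d dv]; exists (c + d); near=> s.
rewrite (le_trans (ler_normD _ _))// mulrDl lerD//.
- by near: s.
- by near: s.
Unshelve. all: by end_near. Qed.

Lemma rateN m u : rate m u -> rate m (fun s => - u s).
Proof.
by move=> [c cu]; exists c; apply: filterS cu => s; rewrite normrN.
Qed.

Lemma eq_rate m u v : u =1 v -> rate m u -> rate m v.
Proof. by move=> uv [c cu]; exists c; apply: filterS cu => s; rewrite uv. Qed.

Lemma rate0 m : rate m (fun=> 0 : V).
Proof. by exists 0; apply: nearW => s; rewrite normr0 mul0r. Qed.

Lemma rateXZ j m (a : V) : (m <= j)%N -> rate m (fun s => s ^+ j *: a).
Proof.
move=> mj; exists `|a|; near=> s.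
have s0 : 0 < s by [].
have s1 : s <= 1 by near: s; exact: nbhs_right_le.
rewrite normrZ mulrC ler_wpM2l// normrX gtr0_norm//.
by rewrite ler_wiXn2l ?(ltW s0).
Unshelve. all: by end_near. Qed.

Lemma rateW m u : rate m.+1 u -> rate m u.
Proof.
move=> [c cu]; exists `|c|; near=> s.
have s0 : 0 < s by [].
have s1 : s <= 1 by near: s; exact: nbhs_right_le.
apply: (@le_trans _ _ (c * s ^+ m.+1)); first by near: s.
rewrite exprS mulrA ler_wpM2r ?exprn_ge0 ?(ltW s0)//.
by rewrite (le_trans (ler_norm _))// normrM (gtr0_norm s0) ler_piMr.
Unshelve. all: by end_near. Qed.

Lemma rateZ m u (k : R) : rate m u -> rate m.+1 (fun s => (k * s) *: u s).
Proof.
move=> [c cu]; exists (`|k| * c); near=> s.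
have s0 : 0 < s by [].
rewrite normrZ normrM (gtr0_norm s0) exprS mulrACA ler_wpM2l//.
  by rewrite mulr_ge0// ltW.
by near: s.
Unshelve. all: by end_near. Qed.

End Rate.

Lemma rateZl {R : realType} {V : normedModType R} m (u : R -> R^o) (a : V) :
  rate m u -> rate m (fun s => u s *: a).
Proof.
move=> [c cu]; exists (c * `|a|); near=> s.
rewrite normrZ mulrAC ler_wpM2r//.
by near: s.
Unshelve. all: by end_near. Qed.

Lemma rate_linear {R : realType} {V W : normedModType R} m
    (L : {linear V -> W}) (u : R -> V) :
  continuous L -> rate m u -> rate m (fun s => L (u s)).
Proof.
move=> /linear_lipschitz[k k0 kP] [c cu]; exists (k * c); near=> s.
by rewrite (le_trans (kP _))// -mulrA ler_pM2l//; near: s.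
Unshelve. all: by end_near. Qed.

(** This transports estimates valid for small increments to the values of a curve at small [s]. *)
Lemma rate_cvg0 {R : realType} {V : normedModType R} (u : R -> V) :
  rate 1 u -> (u s @[s --> 0^'+] --> 0)%classic.
Proof.
move=> [c cu]; apply/cvgr0Pnorm_le => eps eps0; near=> s.
apply: (@le_trans _ _ (c * s ^+ 1)); first by near: s.
have s0 : 0 < s by [].
(* Unlike [c], which may vanish, this constant can be divided by. *)
apply: (@le_trans _ _ ((`|c| + 1) * s)).
  by rewrite ler_wpM2r// ?ltW// (le_lt_trans (ler_norm c))// ltrDl.
rewrite -ler_pdivlMl ?ltr_wpDl//; near: s; apply: nbhs_right_le.
by rewrite mulr_gt0// invr_gt0 ltr_wpDl.
Unshelve. all: by end_near. Qed.

(** * Expansions along curves: scalar fields, one step, the iterates *)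

Definition linearizes {R : realType} {n : nat} (a : 'cV[R]_n -> R) p
    (D : 'cV[R]_n -> R) :=
  forall A (y : R -> 'cV[R]_n), rate 2 (fun s => y s - (p + s *: A)) ->
    rate 2 (fun s => a (y s) - (a p + s * D A) : R^o).

(** The increment [w] is $O(s)$, so the Taylor remainder at [p] is $O(s^2)$; the continuous linear
    map ['d J p] sends the $O(s^2)$ deviation of [y] from $p + s A$ to another $O(s^2)$ term. *)
Lemma twice_differentiable_linearizes {R : realType} {n : nat}
    (J : 'cV[R]_n -> R) p :
  twice_differentiable J -> linearizes J p ('d J p).
Proof.
move=> dJ A y ry.
have dL : continuous ('d J p) by apply: diff_continuous; apply dJ.
pose w s := y s - p.
have rw : rate 1 w.
  apply: (@eq_rate _ _ _ (fun s => (y s - (p + s *: A)) + s ^+ 1 *: A)).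
    by move=> s; rewrite expr1 /w opprD addrA subrK.
  by apply: rateD; [exact: rateW | exact: rateXZ].
have [c c0 /(rate_cvg0 _ rw) cP] := twice_differentiable_taylor J p dJ.
apply: (@eq_rate _ _ _ (fun s => (J (p + w s) - J p - 'd J p (w s)) +
    'd J p (y s - (p + s *: A)) : R^o)).
  move=> s; have -> : p + w s = y s by rewrite /w addrC subrK.
  rewrite /w opprD addrA [X in _ + X]linearB linearZ/=.
  by rewrite /GRing.scale/=; ring.
apply: rateD; last exact: (rate_linear (W := R^o)).
case: rw => d dw; exists (c * d ^+ 2); near=> s.
apply: (@le_trans _ _ (c * `|w s| ^+ 2)); first by near: s.
rewrite -mulrA -exprMn ler_wpM2l// ler_sqr ?nnegrE//.
- by near: s.
- by rewrite (le_trans (normr_ge0 (w s)))//; near: s.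
Unshelve. all: by end_near. Qed.

Lemma linearizesN {R : realType} {n : nat} (a : 'cV[R]_n -> R) p D :
  linearizes a p D -> linearizes (fun x => - a x) p (fun v => - D v).
Proof.
move=> ha A y /ha/rateN; apply: eq_rate => s /=; rewrite opprB; ring.
Qed.

(** The derivative of the field is split as [mu * L] because all steps share one linear form, the
    differential of [J] at [p], while the scalar factor varies from step to step. *)
Definition expands_step {R : realType} {n : nat}
    (Phi : ('cV[R]_n -> 'cV[R]_n) -> R -> 'cV[R]_n -> 'cV[R]_n) (kappa : R) :=
  forall (a : 'cV[R]_n -> R) (e p : 'cV[R]_n) (mu : R)
    (L : {linear 'cV[R]_n -> R}) (y : R -> 'cV[R]_n) A B,
    linearizes a p (fun v => mu * L v) ->
    rate 3 (fun s => y s - (p + s *: A + s ^+ 2 *: B)) ->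
    rate 3 (fun s => Phi (fun x => a x *: e) s (y s) -
      (p + s *: (A + a p *: e) +
       s ^+ 2 *: (B + (mu * L A + kappa * (a p * (mu * L e))) *: e))).

Lemma rate_truncate {R : realType} {V : normedModType R} (y : R -> V) p A B :
  rate 3 (fun s => y s - (p + s *: A + s ^+ 2 *: B)) ->
  rate 2 (fun s => y s - (p + s *: A)).
Proof.
move=> ry.
apply: (@eq_rate _ _ _
  (fun s => (y s - (p + s *: A + s ^+ 2 *: B)) + s ^+ 2 *: B)).
  by move=> s; rewrite opprD addrA subrK.
by apply: rateD; [exact: rateW | exact: rateXZ].
Qed.

(** The new remainder is the old one plus $s$ times the $O(s^2)$ linearization error of [a] at
    [y s]. *)
Lemma euler_expands {R : realType} {n : nat} : @expands_step R n euler_map 0.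
Proof.
move=> a e p mu L y A B ap ry.
have ry2 := rate_truncate _ _ _ _ ry.
apply: (@eq_rate _ _ _ (fun s => (y s - (p + s *: A + s ^+ 2 *: B)) +
    (1 * s) *: ((a (y s) - (a p + s * (mu * L A))) *: e))); last first.
  by apply: rateD => //; apply: rateZ; apply: rateZl; exact: ap.
move=> s; rewrite /euler_map; apply/matrixP => i j; rewrite !mxE; ring.
Qed.

Lemma heun_expands {R : realType} {n : nat} :
  @expands_step R n heun_map (1 / 2).
Proof.
move=> a e p mu L y A B ap ry.
have ry2 := rate_truncate _ _ _ _ ry.
(* The predictor point has first-order coefficient [A + a p *: e], so [ap] applies to it as well;
   half of the added term [a p *: e] produces [kappa = 1/2]. *)
have rz : rate 2
    (fun s => (y s + s *: (a (y s) *: e)) - (p + s *: (A + a p *: e))).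
  apply: (@eq_rate _ _ _ (fun s => (y s - (p + s *: A)) +
      ((1 * s) *: ((a (y s) - (a p + s * (mu * L A))) *: e) +
      s ^+ 2 *: ((mu * L A) *: e)))).
    by move=> s; apply/matrixP => i j; rewrite !mxE; ring.
  apply: rateD => //; apply: rateD; last exact: rateXZ.
  by apply: rateW; apply: rateZ; apply: rateZl; exact: ap.
apply: (@eq_rate _ _ _ (fun s => (y s - (p + s *: A + s ^+ 2 *: B)) +
    (1 / 2 * s) *: (((a (y s) - (a p + s * (mu * L A))) +
      (a (y s + s *: (a (y s) *: e)) -
       (a p + s * (mu * L (A + a p *: e))))) *: e))).
  have LD : L (A + a p *: e) = L A + a p * L e by rewrite linearD linearZ.
  move=> s; rewrite /heun_map LD; apply/matrixP => i j; rewrite !mxE.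
  by field.
apply: rateD => //; apply: rateZ; apply: rateZl.
by apply: rateD; exact: ap.
Qed.

(** The inner sum over [i < j] is the first-order coefficient on arrival at step [j]; each further
    step appends one term to both outer sums. *)
Lemma iterate_expansion {R : realType} {n : nat}
    (Phi : ('cV[R]_n -> 'cV[R]_n) -> R -> 'cV[R]_n -> 'cV[R]_n) (kappa : R)
    (a : nat -> 'cV[R]_n -> R) (e : nat -> 'cV[R]_n) p (mu : nat -> R)
    (L : {linear 'cV[R]_n -> R}) k m :
  expands_step Phi kappa ->
  (forall j, linearizes (a j) p (fun v => mu j * L v)) ->
  rate 3 (fun s => iterate Phi (fun j x => a j x *: e j) s k p m -
    (p + s *: \sum_(k <= j < k + m) a j p *: e j +
     s ^+ 2 *: \sum_(k <= j < k + m)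
       (mu j * L (\sum_(k <= i < j) a i p *: e i) +
        kappa * (a j p * (mu j * L (e j)))) *: e j)).
Proof.
move=> hPhi ha; elim: m => [|m IHm].
  apply: (@eq_rate _ _ _ (fun=> 0)); last exact: rate0.
  by move=> s; rewrite addn0 !big_geq// !scaler0 !addr0 subrr.
by rewrite addnS !(@big_nat_recr _ _ _ (k + m))/= ?leq_addr//; exact: hPhi.
Qed.

(** * From rates in $s$ to $O(h^{3/2})$ in the Euclidean norm *)

Lemma enorm_le {R : realType} {n : nat} (x : 'cV[R]_n) : enorm x <= n%:R * `|x|.
Proof.
rewrite /enorm -[leRHS]ger0_norm ?mulr_ge0// -sqrtr_sqr ler_wsqrtr//.
apply: (@le_trans _ _ (\sum_(i < n) `|x| ^+ 2)).
  apply: ler_sum => i _; rewrite -real_normK ?num_real//.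
  by rewrite ler_sqr ?nnegrE// normr_coord_le.
rewrite sumr_const card_ord -[leLHS]mulr_natl exprMn ler_wpM2r ?sqr_ge0//.
by rewrite -natrX ler_nat; case: (n) => // l; rewrite leq_pmull.
Qed.

Lemma rate_is_O_h32 {R : realType} {n : nat} (u : R -> 'cV[R]_n) :
  rate 3 u -> is_O_h32 (fun h => u (Num.sqrt h)).
Proof.
move=> [c]; rewrite near_withinE => /nbhs_ballP[d /= d0 cP].
have d20 : 0 < d / 2 by rewrite divr_gt0.
(* Adding 1 makes the constant positive; halving [d] puts the closed range $\sqrt h \le d/2$ inside
   the open ball of radius [d]. *)
exists (n%:R * `|c| + 1), ((d / 2) ^+ 2); split.
- by rewrite ltr_wpDl ?mulr_ge0.
- by rewrite exprn_gt0.
move=> h /andP[h0 hd].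
have s0 : 0 < Num.sqrt h by rewrite sqrtr_gt0.
have -> : h `^ (3 / 2) = Num.sqrt h ^+ 3.
  by rewrite mulrC powRrM powR12_sqrt ?ltW// powR_mulrn ?sqrtr_ge0.
have sd : Num.sqrt h < d.
  apply: (@le_lt_trans _ _ (d / 2)); last first.
    by rewrite ltr_pdivrMr// ltr_pMr// ltr1n.
  by rewrite -[leRHS]gtr0_norm// -sqrtr_sqr ler_wsqrtr.
have /cP : ball 0 d (Num.sqrt h).
  by rewrite -ball_normE/= sub0r normrN gtr0_norm.
move=> /(_ s0) us; apply: le_trans (enorm_le _) _.
rewrite mulrDl mul1r ler_wpDr ?exprn_ge0 ?sqrtr_ge0// -mulrA ler_wpM2l//.
by rewrite (le_trans us)// ler_wpM2r ?ler_norm ?exprn_ge0 ?sqrtr_ge0.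
Qed.

(** * Sums over one period of the four-step pattern *)

Definition quarter {R : zmodType} (S C : R) (j : nat) : R :=
  match (j %% 4)%N with 0%N => S | 1%N => C | 2%N => - S | _ => - C end.

Lemma quarter_block (R : zmodType) (S C : R) q r :
  quarter S C (q * 4 + r) = quarter S C r.
Proof. by rewrite /quarter modnMDl. Qed.

(** Moving the window from [k] to [k.+1] trades [F k] for the equal term [F (k + N)]. *)
Lemma sum_period (V : zmodType) (F : nat -> V) N k :
  (forall j, F (j + N)%N = F j) ->
  \sum_(k <= j < k + N) F j = \sum_(0 <= j < N) F j.
Proof.
move=> FN; elim: k => [//|k <-]; apply: (addrI (F k)).
rewrite addSn -big_ltn ?ltnS ?leq_addr// big_nat_recr/= ?leq_addr//.
by rewrite FN addrC.
Qed.

(** The index [q * 4 + 0] keeps its zero so that [quarter_block] and [unit_vec_block] rewrite all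
    four terms alike. *)
Lemma sum_blocks4 (V : zmodType) (F : nat -> V) n :
  \sum_(0 <= j < 4 * n) F j =
  \sum_(0 <= q < n) (F (q * 4 + 0)%N + F (q * 4 + 1)%N +
                       F (q * 4 + 2)%N + F (q * 4 + 3)%N).
Proof.
elim: n => [|n IHn]; first by rewrite !big_geq.
rewrite mulnSr !addnS addn0 !big_nat_recr//= IHn !addrA.
by rewrite [(4 * n)%N]mulnC !addnS !addn0.
Qed.

Section SecondOrder.

Variables (R : realType) (n : nat) (L : {linear 'cV[R]_n -> R}) (S C : R).
Let e j := unit_vec R n ((j %/ 4) %% n).
Let alpha := quarter S C.
(** Differentiation advances the cycle sin, cos, -sin, -cos by one place, so this is the derivative
    factor belonging to [alpha j]. *)
Let mu j := quarter S C j.+1.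

Lemma quarter_period j : alpha (j + 4 * n) = alpha j.
Proof. by rewrite /alpha mulnC addnC quarter_block. Qed.

Lemma unit_vec_period j : e (j + 4 * n) = e j.
Proof. by rewrite /e mulnC addnC divnMDl// modnDl. Qed.

Lemma unit_vec_block q r : (r < 4)%N -> e (q * 4 + r) = unit_vec R n (q %% n).
Proof. by move=> r4; rewrite /e divnMDl// divn_small// addn0. Qed.

(** The direction is constant on each block of four, and $S + C - S - C = 0$. *)
Lemma sum_field_period k : \sum_(k <= j < k + 4 * n) alpha j *: e j = 0.
Proof.
rewrite sum_period => [|j]; last by rewrite quarter_period unit_vec_period.
rewrite sum_blocks4 big1// => q _.
rewrite !unit_vec_block// -!scalerDl /alpha !quarter_block /quarter/=.
by rewrite [_ + _](_ : _ = 0) ?scale0r//; ring.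
Qed.

(** The inner sums start at [k], so [sum_period] does not apply directly. Measuring them from 0
    gives the periodic summand [F], at the price of the correction [G]. The sum of [F] is then
    computed block by block, each block starting with partial sum 0. *)
Lemma sum_second_order (kappa : R) k : S ^+ 2 + C ^+ 2 = 1 ->
  \sum_(k <= j < k + 4 * n)
     (mu j * L (\sum_(k <= i < j) alpha i *: e i) +
      kappa * (alpha j * (mu j * L (e j)))) *: e j =
  - \col_i L (unit_vec R n i).
Proof.
move=> SC1.
pose A j := \sum_(0 <= i < j) alpha i *: e i.
have muP j : mu (j + 4 * n) = mu j := quarter_period j.+1.
have AP j : A (j + 4 * n)%N = A j.
  by rewrite /A (big_cat_nat (n := j))//= ?leq_addr// sum_field_period addr0.
pose F j := (mu j * L (A j) + kappa * (alpha j * (mu j * L (e j)))) *: e j.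
pose G j := (mu j * L (A k)) *: e j.
(* [A j - A k] is the partial sum from [k]; the [G j] cancel in each block. *)
transitivity (\sum_(k <= j < k + 4 * n) F j - \sum_(k <= j < k + 4 * n) G j).
  rewrite -sumrB; apply: eq_big_nat => j /andP[kj _]; rewrite /F /G -scalerBl.
  rewrite /A [in RHS](big_cat_nat (n := k))//= linearD/=.
  by congr (_ *: _); ring.
have FP j : F (j + 4 * n)%N = F j.
  by rewrite /F muP AP quarter_period unit_vec_period.
have GP j : G (j + 4 * n)%N = G j by rewrite /G muP unit_vec_period.
rewrite (sum_period _ _ _ _ FP) (sum_period _ _ _ _ GP).
have A0 q : A (q * 4)%N = 0.
  rewrite /A mulnC sum_blocks4 big1// => i _.
  rewrite !unit_vec_block// -!scalerDl /alpha !quarter_block /quarter/=.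
  by rewrite [_ + _](_ : _ = 0) ?scale0r//; ring.
have AS j : A j.+1 = A j + alpha j *: e j by rewrite /A big_nat_recr.
rewrite !sum_blocks4 [X in _ - X]big1 ?subr0; last first.
  move=> q _; rewrite /G !unit_vec_block// -!scalerDl /mu -!addnS.
  rewrite !quarter_block /quarter/=.
  by rewrite [_ + _](_ : _ = 0) ?scale0r//; ring.
transitivity (\sum_(0 <= q < n) - (L (unit_vec R n q) *: unit_vec R n q)).
  apply: eq_big_nat => q /andP[_ qn].
  have A0q : A (q * 4 + 0)%N = 0 by rewrite addn0.
  have ASq r : (r < 4)%N ->
      A (q * 4 + r.+1)%N = A (q * 4 + r)%N + quarter S C r *: unit_vec R n q.
    move=> r4; rewrite addnS AS unit_vec_block// modn_small//.
    by rewrite /alpha quarter_block.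
  rewrite /F !unit_vec_block// modn_small// -!scalerDl -scaleNr; congr (_ *: _).
  rewrite !ASq// A0q add0r /mu /alpha -!addnS !quarter_block /quarter/=.
  rewrite -!scalerDl.
  (* Within a block the partial sums are $0, S, S + C, C$ times the unit vector; weighted by $C, -S,
     -C, S$ they add up to $-(S^2 + C^2)$. The [kappa] products $SC, -SC, SC, -SC$ cancel. *)
  rewrite linear0 !linearZ/= -[X in _ = - X]mul1r -SC1 /GRing.scale/=; ring.
rewrite big_mkord sumrN; congr (- _); apply/matrixP => i j.
rewrite summxE (bigD1 i)//= big1 ?addr0 ?mxE ?eqxx ?mulr1//.
by move=> l li; rewrite !mxE val_eqE eq_sym (negbTE li) mulr0.
Qed.

End SecondOrder.

(** * The switched field and the descent estimate *)

Lemma switched_fieldE {R : realType} {n : nat} (f1 f2 : 'cV[R]_n -> R) k x :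
  switched_field f1 f2 k x =
  quarter (f1 x) (f2 x) k *: unit_vec R n ((k %/ 4) %% n).
Proof. by rewrite /switched_field /quarter; case: (k %% 4)%N => [|[|[|]]]. Qed.

Lemma quarter_linearizes {R : realType} {n : nat} (J : 'cV[R]_n -> R) p j :
  twice_differentiable J ->
  linearizes (fun x => quarter (sin (J x)) (cos (J x)) j) p
    (fun v => quarter (sin (J p)) (cos (J p)) j.+1 * 'd J p v).
Proof.
move=> hJ.
have dsin (t : R) : differentiable (@sin R) t by exact/derivable1_diffP.
have dcos (t : R) : differentiable (@cos R) t by exact/derivable1_diffP.
have lsin : linearizes (sin \o J) p (fun v => cos (J p) * 'd J p v).
  have [h dE] := twice_differentiable_comp J sin cos (@is_derive_sin R) dcos hJ.
  rewrite (_ : (fun v => _) = 'd (sin \o J) p).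
    exact: twice_differentiable_linearizes.
  by apply/funext => v; rewrite dE.
have lcos : linearizes (cos \o J) p (fun v => - sin (J p) * 'd J p v).
  have dNsin (t : R) : differentiable (fun t => - sin t : R) t.
    exact: differentiableN.
  have [h dE] := twice_differentiable_comp J cos _ (@is_derive_cos R) dNsin hJ.
  rewrite (_ : (fun v => _) = 'd (cos \o J) p).
    exact: twice_differentiable_linearizes.
  by apply/funext => v; rewrite dE.
(* The successor is moved onto the residue before reduction: at residue 3 the derivative index is 4,
   which [quarter] wraps around to sin. *)
rewrite (divn_eq j 4) -addnS quarter_block.
rewrite (_ : (fun x => _) =
  fun x => quarter (sin (J x)) (cos (J x)) (j %% 4)); last first.
  by apply/funext => x; rewrite quarter_block.
move: (j %% 4)%N (ltn_pmod j (isT : 0 < 4)%N) => [|[|[|[|//]]]] _ //.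
- have := linearizesN _ _ _ lsin.
  rewrite [X in linearizes _ _ X](_ : _ = fun v => - cos (J p) * 'd J p v)//.
  by apply/funext => v; rewrite mulNr.
- have := linearizesN _ _ _ lcos.
  rewrite [X in linearizes _ _ X](_ : _ = fun v => sin (J p) * 'd J p v)//.
  by apply/funext => v; rewrite mulNr opprK.
Qed.

Lemma switched_descent {R : realType} {n : nat}
    (Phi : ('cV[R]_n -> 'cV[R]_n) -> R -> 'cV[R]_n -> 'cV[R]_n) (kappa : R)
    (J : 'cV[R]_n -> R) :
  expands_step Phi kappa -> twice_differentiable J ->
  let g := switched_field (fun x => sin (J x)) (fun x => cos (J x)) in
  forall (k : nat) (xk : 'cV[R]_n),
     exists r : R -> 'cV[R]_n, is_O_h32 r /\
       forall h : R, 0 < h ->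
         iterate Phi g (Num.sqrt h) k xk (4 * n)
         = xk - h *: gradient J xk + r h.
Proof.
move=> hPhi hJ g k p.
(* Taking the remainder to be the difference itself makes the equation immediate via $(\sqrt h)^2 =
   h$; only its rate in $s$ remains. *)
pose u s := iterate Phi g s k p (4 * n) - (p - s ^+ 2 *: gradient J p).
exists (fun h => u (Num.sqrt h)); split; last first.
  by move=> h h0; rewrite /u sqr_sqrtr ?ltW// addrC subrK.
apply: rate_is_O_h32.
have gE : g = fun j x => quarter (sin (J x)) (cos (J x)) j *:
    unit_vec R n ((j %/ 4) %% n).
  by apply/funext => j; apply/funext => x; rewrite /g switched_fieldE.
have gradE : \col_i 'd J p (unit_vec R n i) = gradient J p.
  by apply/matrixP => i j; rewrite !mxE deriveE//; apply hJ.
have := iterate_expansion Phi kappa _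
  (fun j => unit_vec R n ((j %/ 4) %% n)) p _ ('d J p)
  k (4 * n) hPhi (fun j => quarter_linearizes J p j hJ).
rewrite sum_field_period sum_second_order; last by rewrite addrC cos2Dsin2.
rewrite gradE -gE; apply: eq_rate => s.
by rewrite /u scaler0 addr0 scalerN.
Qed.

Theorem theorem1 (R : realType) (n : nat) (hn : (1 <= n)%N)
    (J : 'cV[R]_n -> R) (hJ : twice_differentiable J) :
  let g := switched_field (fun x => sin (J x)) (fun x => cos (J x)) in
  (forall (k : nat) (xk : 'cV[R]_n),
     exists r : R -> 'cV[R]_n, is_O_h32 r /\
       forall h : R, 0 < h ->
         iterate euler_map g (Num.sqrt h) k xk (4 * n)
         = xk - h *: gradient J xk + r h)
  /\
  (forall (k : nat) (xk : 'cV[R]_n),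
     exists r : R -> 'cV[R]_n, is_O_h32 r /\
       forall h : R, 0 < h ->
         iterate heun_map g (Num.sqrt h) k xk (4 * n)
         = xk - h *: gradient J xk + r h).
Proof.
split; apply: switched_descent => //.
- exact: euler_expands.
- exact: heun_expands.
Qed.
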